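(* Let $p$ be a prime greater than $2$, $m$ a positive integer, and $f \colon GF(p)^{2m} \to GF(p)$ an even function with $f(0)=0$. Suppose that the component Cayley graphs $\Gamma_i$ ($1\le i\le p$) of $f$ are all strongly regular and are either all of feasible Latin square type or all of feasible negative Latin square type. Then the component Cayley graphs $\Gamma_i^*$ of the dual function $f^*$ are also all strongly regular, and for each $i$ the parameters of $\Gamma_i^*$ equal those of $\Gamma_i$.
   Context: Let $\zeta = e^{2\pi i/p}$, identify $GF(p)$ with $\{0,\dots,p-1\}$, $\langle\ ,\ \rangle$ the standard inner product; $W_f(x) = \sum_y \zeta^{f(y)-\langle x,y\rangle}$. For an even $g\colon GF(p)^{2m}\to GF(p)$ with $g(0)=0$: its level sets are $g^{-1}(i)$ for $1 \le i \le p-1$ and $g^{-1}(0)\setminus\{0\}$ (index $p$), and its $i$th component Cayley graph is the graph on $GF(p)^{2m}$ with distinct $x,y$ adjacent iff $x-y$ lies in the $i$th level set. A strongly regular graph with parameters $(\nu,k,\lambda,\mu)$ is $k$-regular on $\nu$ vertices, adjacent vertices having $\lambda$ and distinct nonadjacent vertices $\mu$ common neighbors. The graphs $\Gamma_i$ are all of feasible Latin square type (resp. feasible negative Latin square type) if each $\Gamma_i$ is strongly regular with parameters $(N^2,(N-1)r_i, N+r_i^2-3r_i, r_i^2-r_i)$, where $N=p^m$ (resp. $N=-p^m$), $r_i = N/p$ for $1\le i\le p-1$, $r_p = N/p+1$. Under these hypotheses $f$ is bent with $W_f(x) = \zeta^{f^*(x)}p^m$ (Latin case) or $W_f(x) =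 -\zeta^{f^*(x)}p^m$ (negative Latin case) for a unique $f^*\colon GF(p)^{2m}\to GF(p)$, the dual of $f$, which is even with $f^*(0)=0$; $\Gamma_i^*$ is the $i$th component Cayley graph of $f^*$. *)

(* Defs.v *)
From HB Require Import structures.
From mathcomp Require Import all_boot all_order all_algebra.
From mathcomp Require Import complex.
From mathcomp Require Import reals trigo.

Set Implicit Arguments.
Unset Strict Implicit.
Unset Printing Implicit Defensive.

Import Order.TTheory GRing.Theory Num.Theory.
Local Open Scope ring_scope.

(* e^(2 pi i / p) *)
Definition zeta (R : realType) (p : nat) : R[i] :=
  (cos (2 * pi / p%:R) +i* sin (2 * pi / p%:R))%C.

Definition dot (F : pzRingType) (n : nat) (x y : 'rV[F]_n) : F :=
  \sum_(j < n) x 0 j * y 0 j.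

(* The exponent is an element of 'F_p, coerced to its representative in
   {0, ..., p - 1}. *)
Definition walsh (R : realType) (p n : nat) (f : 'rV['F_p]_n -> 'F_p)
    (x : 'rV['F_p]_n) : R[i] :=
  \sum_(y : 'rV['F_p]_n) zeta R p ^+ (f y - dot x y)%R.

(* For N = p ^ m (resp. N = - p ^ m), the two cases W_f = zeta ^ f* p ^ m
   (resp. W_f = - zeta ^ f* p ^ m) of the definition of the dual f* of f. *)
Definition is_dual (R : realType) (p n : nat) (N : int)
    (f fstar : 'rV['F_p]_n -> 'F_p) : Prop :=
  forall x, walsh R f x = zeta R p ^+ (fstar x) * N%:~R.

Definition even_fun (U : zmodType) (T : Type) (f : U -> T) : Prop :=
  forall x, f (- x) = f x.

Definition level_set (p n : nat) (f : 'rV['F_p]_n -> 'F_p) (i : nat) :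
    {set 'rV['F_p]_n} :=
  if i == p then [set x | (f x == 0) && (x != 0)]
  else [set x | nat_of_ord (f x) == i].

Definition component_graph (p n : nat) (f : 'rV['F_p]_n -> 'F_p) (i : nat) :
    rel 'rV['F_p]_n :=
  fun x y => (x != y) && (x - y \in level_set f i).

(* The parameters are integers: the feasible value of lambda is - p for the
   edgeless graph occurring as the p-th component when N = - p, where the
   condition on adjacent vertices is vacuous. *)
Definition strongly_regular (T : finType) (e : rel T) (v k l mu : int) : Prop :=
  [/\ symmetric e /\ irreflexive e,
      #|T|%:Z = v,
      forall x, #|[set z | e x z]|%:Z = k,
      forall x y, e x y -> #|[set z | e x z && e y z]|%:Z = l &
      forall x y, x != y -> ~~ e x y -> #|[set z | e x z && e y z]|%:Z = mu].

Definition feasible_r (p : nat) (N : int) (i : nat) : int :=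
  if i == p then (N %/ p%:Z)%Z + 1 else (N %/ p%:Z)%Z.

(* Feasible Latin square type for N = p ^ m, feasible negative Latin square
   type for N = - p ^ m. *)
Definition all_feasible_type (p n : nat) (N : int)
    (f : 'rV['F_p]_n -> 'F_p) : Prop :=
  forall i : nat, (1 <= i <= p)%N ->
    let r := feasible_r p N i in
    strongly_regular (component_graph f i)
      (N ^+ 2) ((N - 1) * r) (N + r ^+ 2 - 3 * r) (r ^+ 2 - r).

(* Main.v *)
Require Import Defs.
From HB Require Import structures.
From mathcomp Require Import all_boot all_order all_algebra.
From mathcomp Require Import complex ring.
From mathcomp Require Import reals trigo.

Set Implicit Arguments.
Unset Strict Implicit.
Unset Printing Implicit Defensive.

Import Order.TTheory GRing.Theory Num.Theory.
Local Open Scope ring_scope.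

(* The eigenvalues of a Cayley graph of an abelian group are the Fourier
   coefficients of its connection set. For a fibre A = f^-1(t) of f and
   q = N / p, the Latin square parameters say exactly that the Fourier transform
   of the indicator of A is N 1_E - q + q N 1_{0} for some set E that contains 0
   if and only if A does. By Fourier inversion this relation between A and E is
   symmetric, so E yields a graph with the same parameters as A. Summing over t,
   the indicators of the sets E_t add up to 1: these sets are the fibres of a
   function f*. Since the sum of the zeta ^ t vanishes, W_f(x) is the sum of the
   N zeta ^ t 1_{E_t}(x), that is N zeta ^ f*(x), so f* is the dual of f. *)

Lemma card_zmod_gt0 (V : finZmodType) : (0 < #|V|)%N.
Proof. by apply/card_gt0P; exists 0. Qed.

Section Characters.

Variables (V : finZmodType) (C : idomainType).

Definition additive_character (c : V -> C) : Prop :=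
  c 0 = 1 /\ {morph c : x y / x + y >-> x * y}.

Record self_duality (e : V -> V -> C) : Prop := {
  self_duality_sym : forall x y, e x y = e y x;
  self_duality_character : forall x, additive_character (e x);
  self_duality_nondeg : forall x, x != 0 -> exists y, e x y != 1 }.

Lemma sum_additive_character (c : V -> C) z :
  additive_character c -> c z != 1 -> \sum_x c x = 0.
Proof.
move=> [_ cD] cz; have {}cz : c z - 1 != 0 by rewrite subr_eq0.
apply: (mulfI cz); rewrite mulr0 mulrBl mul1r mulr_sumr.
rewrite [X in _ - X](reindex_inj (addrI z)) /=.
by under [X in _ - X]eq_bigr do rewrite cD; rewrite subrr.
Qed.

End Characters.

Section Fourier.

Variables (V : finZmodType) (C : idomainType) (e : V -> V -> C).
Hypothesis e_dual : self_duality e.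
Implicit Types (g h : V -> C) (a b : C) (x y z : V) (D : {set V}).

Definition fourier g x : C := \sum_y g y * e x y.

Definition convolution g h z : C := \sum_y g y * h (z - y).

Definition indic D x : C := (x \in D)%:R.

Let eC := self_duality_sym e_dual.

Let e0 x : e x 0 = 1.
Proof. by case: (self_duality_character e_dual x). Qed.

Let eD x y z : e x (y + z) = e x y * e x z.
Proof. by case: (self_duality_character e_dual x). Qed.

Lemma sum_self_duality x : \sum_y e x y = #|V|%:R * (x == 0)%:R.
Proof.
have [->|/(self_duality_nondeg e_dual)[y exy]] := eqVneq x 0.
  by under eq_bigr do rewrite eC e0; rewrite sumr_const mulr1.
by rewrite mulr0 (sum_additive_character (self_duality_character _ x) exy).
Qed.

Lemma eq_fourier g h : g =1 h -> fourier g =1 fourier h.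
Proof. by move=> gh x; apply: eq_bigr => y _; rewrite gh. Qed.

Lemma fourier_linear a g h x :
  fourier (fun y => a * g y + h y) x = a * fourier g x + fourier h x.
Proof.
rewrite mulr_sumr -big_split; apply: eq_bigr => y _ /=.
by rewrite mulrDl mulrA.
Qed.

Lemma fourier_cst a x : fourier (fun=> a) x = a * (#|V|%:R * (x == 0)%:R).
Proof. by rewrite -sum_self_duality mulr_sumr. Qed.

Lemma fourier_delta x : fourier (fun y => (y == 0)%:R) x = 1.
Proof.
rewrite /fourier (bigD1 0) //= eqxx e0 mulr1.
by rewrite big1 ?addr0 // => y /negPf ->; rewrite mul0r.
Qed.

Lemma fourier_indic0 D : fourier (indic D) 0 = #|D|%:R.
Proof.
rewrite /fourier; under eq_bigr do rewrite eC e0 mulr1.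
by rewrite -natr_sum -sum1_card [in RHS]big_mkcond.
Qed.

Lemma fourier_even g : even_fun g -> even_fun (fourier g).
Proof.
move=> g_even x; rewrite /fourier (reindex_inj oppr_inj) /=.
apply: eq_bigr => y _; rewrite g_even.
have eN u v : e u (- v) * e u v = 1 by rewrite -eD addNr e0.
have eNN : e (- x) (- y) * e (- x) y = e x y * e (- x) y.
  by rewrite eN mulrC eC (eC x) eN.
suff /mulIf/(_ _ _ eNN) -> : e (- x) y != 0 by [].
by apply: contra_eq_neq (eN (- x) y) => ->; rewrite mulr0 eq_sym oner_eq0.
Qed.

Lemma fourier_convolution g h x :
  fourier (convolution g h) x = fourier g x * fourier h x.
Proof.
rewrite /fourier /convolution; under eq_bigr do rewrite mulr_suml.
rewrite exchange_big /= mulr_suml; apply: eq_bigr => y _.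
rewrite (reindex_inj (addrI y)) /= mulr_sumr; apply: eq_bigr => z _.
by rewrite [y + z]addrC addrK addrC eD mulrACA.
Qed.

Lemma fourier_fourier g z : fourier (fourier g) z = #|V|%:R * g (- z).
Proof.
rewrite /fourier; under eq_bigr do rewrite mulr_suml.
rewrite exchange_big /=.
transitivity (\sum_y g y * (#|V|%:R * (y + z == 0)%:R)).
  apply: eq_bigr => y _; rewrite -sum_self_duality mulr_sumr.
  by apply: eq_bigr => x _; rewrite -mulrA (eC z) -eD (eC x).
rewrite (bigD1 (- z)) //= addNr eqxx mulr1 mulrC big1 ?addr0 // => y yz.
by rewrite addr_eq0 (negPf yz) !mulr0.
Qed.

Lemma fourier_inj g h :
  #|V|%:R != 0 :> C -> fourier g =1 fourier h -> g =1 h.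
Proof.
move=> V_neq0 gh z; apply: (mulfI V_neq0).
by rewrite -[z]opprK -!fourier_fourier; apply: eq_fourier.
Qed.

Lemma fourier_comp (A : finType) (f : V -> A) (c : A -> C) x :
  fourier (c \o f) x = \sum_a c a * fourier (indic (f @^-1: [set a])) x.
Proof.
under [RHS]eq_bigr do rewrite mulr_sumr; rewrite exchange_big /=.
apply: eq_bigr => y _; rewrite (bigD1 (f y)) //= /indic !inE eqxx mul1r.
by rewrite big1 ?addr0 // => a /negPf fya; rewrite !inE eq_sym fya mul0r mulr0.
Qed.

End Fourier.

Lemma strongly_regular_has_nbr (T : finType) (adj : rel T) v k l mu x :
  strongly_regular adj v k l mu -> [exists y, adj x y] = (0 < k).
Proof.
case=> _ _ kE _ _; rewrite -(kE x) ltz_nat.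
by apply/existsP/card_gt0P => -[y xy]; exists y; rewrite inE in xy *.
Qed.

Lemma strongly_regular_has_non_nbr (T : finType) (adj : rel T) v k l mu x :
  strongly_regular adj v k l mu ->
  [exists y, (x != y) && ~~ adj x y] = (k + 1 < v).
Proof.
case=> [[_ adj_irr] vE kE _ _]; set nbr := [set y | adj x y].
have -> : (k + 1 < v) = (x |: nbr != setT).
  have := subset_leqif_cards (subsetT (x |: nbr)).
  rewrite cardsU1 inE adj_irr cardsT add1n => cardE.
  by rewrite -vE -(kE x) ltz_nat addn1 ltn_neqAle cardE cardE andbT.
rewrite -subTset; apply/existsP/subsetPn => -[y].
  by case/andP=> xy nxy; exists y; rewrite ?inE // negb_or eq_sym xy.
by rewrite !inE negb_or eq_sym => _ ?; exists y.
Qed.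

(* The parameters of a strongly regular graph need not be unique: lambda is
   arbitrary in an edgeless graph and mu in a complete one. *)
Lemma strongly_regular_same_params (S T : finType) (adj1 : rel S) (adj2 : rel T)
    v k l mu v' k' l' mu' :
    strongly_regular adj1 v k l mu -> strongly_regular adj2 v k l mu ->
  strongly_regular adj1 v' k' l' mu' -> strongly_regular adj2 v' k' l' mu'.
Proof.
move=> srg1 srg2 [_ v1' k1' l1' mu1'].
have [_ v1 k1 l1 mu1] := srg1; have [simple2 v2 k2 l2 mu2] := srg2.
have S_inhabited (y : T) : exists x : S, x \in S.
  apply/card_gt0P; rewrite -ltz_nat v1 -v2 ltz_nat.
  by apply/card_gt0P; exists y.
split=> // [|y|y y' adj|y y' yy' nadj]; first by rewrite v2 -v1.
- by have [x _] := S_inhabited y; rewrite k2 -(k1 x).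
- have [x _] := S_inhabited y.
  have /existsP[x' xx'] : [exists x', adj1 x x'].
    rewrite (strongly_regular_has_nbr x srg1).
    rewrite -(strongly_regular_has_nbr y srg2).
    by apply/existsP; exists y'.
  by rewrite l2 // -(l1 x x') // l1'.
have [x _] := S_inhabited y.
have /existsP[x' /andP[xx' nxx']] : [exists x', (x != x') && ~~ adj1 x x'].
  rewrite (strongly_regular_has_non_nbr x srg1).
  rewrite -(strongly_regular_has_non_nbr y srg2).
  by apply/existsP; exists y'; rewrite yy'.
by rewrite mu2 // -(mu1 x x') // mu1'.
Qed.

Section CayleyGraph.

Variables (V : finZmodType) (C : numDomainType).
Implicit Types (x y z : V) (D : {set V}).
Local Notation indic := (indic C).

Definition cayley D : rel V := fun x y => (x != y) && (x - y \in D).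

Lemma oppr_closedE D x : oppr_closed D -> (- x \in D) = (x \in D).
Proof. by move=> D_opp; apply/idP/idP => /D_opp; rewrite ?opprK. Qed.

Variable D : {set V}.
Hypotheses (D_opp : oppr_closed D) (D_0 : 0 \notin D).

Lemma cayleyE x y : cayley D x y = (x - y \in D).
Proof.
by rewrite /cayley; case: eqVneq => //= ->; rewrite subrr (negPf D_0).
Qed.

Lemma cayley_sym : symmetric (cayley D).
Proof. by move=> x y; rewrite !cayleyE -opprB oppr_closedE. Qed.

Lemma cayley_irr : irreflexive (cayley D).
Proof. by move=> x; rewrite /cayley eqxx. Qed.

Lemma card_common_nbr x y :
  #|[set z | cayley D x z && cayley D y z]|%:R =
  convolution (indic D) (indic D) (x - y).
Proof.
rewrite /convolution (reindex_inj (subrI x)) /= -sum1_card natr_sum big_mkcond.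
apply: eq_bigr => z _; rewrite inE !cayleyE /indic.
have -> : x - y - (x - z) = - (y - z) by rewrite !opprB addrC addrA subrK.
by rewrite oppr_closedE //; do 2!case: (_ \in D); rewrite ?mulr1 ?mulr0.
Qed.

Lemma card_nbr x : #|[set z | cayley D x z]| = #|D|.
Proof.
rewrite -(card_imset _ (subrI x)) /=; congr #|pred_of_set _|; apply/setP => z.
by rewrite -[z](subKr x) (mem_imset _ _ (subrI x)) inE cayleyE (subKr x).
Qed.

Lemma convolution_indic0 : convolution (indic D) (indic D) 0 = #|D|%:R.
Proof.
rewrite -(subrr 0) -card_common_nbr -(card_nbr 0).
by congr (#|pred_of_set _|%:R); apply/setP => z; rewrite !inE andbb.
Qed.

Lemma strongly_regular_convolution v k l mu :
  strongly_regular (cayley D) v k l mu <->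
  #|V|%:Z = v /\
  forall z, convolution (indic D) (indic D) z = k%:~R * (z == 0)%:R
    + l%:~R * indic D z + mu%:~R * (1 - (z == 0)%:R - indic D z).
Proof.
split=> [[_ vE kE lE muE] | [vE convE]].
  split=> // z; have [->|z_neq0] := eqVneq z 0.
    rewrite convolution_indic0 /indic (negPf D_0) pmulrn -(card_nbr 0) kE /=.
    ring.
  have z_adj : cayley D z 0 = (z \in D) by rewrite cayleyE subr0.
  rewrite -[z]subr0 -card_common_nbr !subr0 /indic pmulrn.
  case: (boolP (z \in D)) => zD.
    rewrite lE ?z_adj //=; ring.
  rewrite muE ?z_adj //=; ring.
have eqzC (a b : int) : a%:~R = b%:~R :> C -> a = b by move/intr_inj.
split=> // [|x|x y xy|x y xy nadj].
- by split; [apply: cayley_sym | apply: cayley_irr].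
- apply: eqzC; rewrite card_nbr -pmulrn -convolution_indic0 convE.
  rewrite eqxx /indic (negPf D_0) /=; ring.
- apply: eqzC; rewrite -pmulrn card_common_nbr convE /indic -cayleyE xy.
  rewrite subr_eq0; case/andP: xy => /negPf -> _ /=; ring.
apply: eqzC; rewrite -pmulrn card_common_nbr convE /indic -cayleyE.
rewrite (negPf nadj) subr_eq0 (negPf xy) /=; ring.
Qed.

Variable e : V -> V -> C.
Hypothesis e_dual : self_duality e.

Lemma strongly_regular_fourier v k l mu :
  strongly_regular (cayley D) v k l mu <->
  #|V|%:Z = v /\
  forall x, fourier e (indic D) x ^+ 2 =
    (k - mu)%:~R + (l - mu)%:~R * fourier e (indic D) x
    + mu%:~R * (#|V|%:R * (x == 0)%:R).
Proof.
pose rhs z : C := (k - mu)%:~R * (z == 0)%:R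
  + ((l - mu)%:~R * indic D z + mu%:~R).
have rhsE x : fourier e rhs x = (k - mu)%:~R
    + (l - mu)%:~R * fourier e (indic D) x + mu%:~R * (#|V|%:R * (x == 0)%:R).
  by rewrite !fourier_linear fourier_delta // fourier_cst // mulr1 addrA.
have rhs_ring z : rhs z = k%:~R * (z == 0)%:R
    + l%:~R * indic D z + mu%:~R * (1 - (z == 0)%:R - indic D z).
  rewrite /rhs; ring.
have V_neq0 : #|V|%:R != 0 :> C by rewrite pnatr_eq0 -lt0n card_zmod_gt0.
rewrite strongly_regular_convolution; split=> -[vE srgE]; split=> // z.
  rewrite expr2 -fourier_convolution // -rhsE.
  by apply: eq_fourier => y; rewrite srgE rhs_ring.
rewrite -rhs_ring.
apply: (fourier_inj e_dual V_neq0 (g := convolution _ _) (h := rhs)) => x.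
by rewrite fourier_convolution // rhsE -srgE.
Qed.

End CayleyGraph.

Lemma set_partition_fibres (S T : finType) (E : T -> {set S}) :
  (forall x, \sum_t (x \in E t) = 1)%N ->
  exists g : S -> T, forall t, E t = g @^-1: [set t].
Proof.
move=> sumE; have /fin_all_exists[g gE] x :
    exists s, forall t, (x \in E t) = (s == t).
  have /eqP/sum_nat_eq1[s [_ xEs xEt]] := sumE x; exists s => t.
  have [<-|st] := eqVneq s t; first by case: (x \in E s) xEs.
  by have := xEt t; rewrite eq_sym st => /(_ isT isT); case: (x \in E t).
by exists g => t; apply/setP => x; rewrite gE !inE.
Qed.

Section LatinSquareType.

Variables (V : finZmodType) (C : numDomainType) (e : V -> V -> C) (N q : int).
Hypotheses (e_dual : self_duality e) (N_sqr : N ^+ 2 = #|V|%:Z).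
Implicit Types (x : V) (A E : {set V}).
Local Notation fourier := (fourier e).
Local Notation indic := (indic C).

Let N_neq0 : N%:~R != 0 :> C.
Proof. by rewrite intr_eq0 -sqrf_eq0 N_sqr eqz_nat -lt0n card_zmod_gt0. Qed.

Let cardV : #|V|%:R = N%:~R ^+ 2 :> C.
Proof. by rewrite -rmorphXn /= N_sqr -pmulrn. Qed.

Definition latin_square_graph (r : int) (adj : rel V) : Prop :=
  strongly_regular adj
    (N ^+ 2) ((N - 1) * r) (N + r ^+ 2 - 3 * r) (r ^+ 2 - r).

Lemma latin_square_graph_eigenvalue A r x :
    oppr_closed A -> 0 \notin A -> latin_square_graph r (cayley A) -> x != 0 ->
  fourier (indic A) x = (N - r)%:~R \/ fourier (indic A) x = (- r)%:~R.
Proof.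
move=> A_opp A_0 A_latin x_neq0.
have [_ /(_ x)] :=
  (strongly_regular_fourier A_opp A_0 e_dual _ _ _ _).1 A_latin.
rewrite (negPf x_neq0) !mulr0 addr0; set F := fourier _ _ => eigenE.
have /eqP : (F - (N - r)%:~R) * (F - (- r)%:~R) = 0 by ring: eigenE.
by rewrite mulf_eq0 !subr_eq0 => /orP[]/eqP; [left | right].
Qed.

Definition latin_dual_set A E : Prop :=
  (0 \in E) = (0 \in A) /\ forall x,
    fourier (indic A) x = N%:~R * indic E x + q%:~R * (N%:~R * (x == 0)%:R - 1).

Lemma fourier_indicD0 A x :
  fourier (indic A) x = (0 \in A)%:R + fourier (indic (A :\ 0)) x.
Proof.
rewrite -[X in X + _]mulr1 -[X in _ * X + _](fourier_delta e_dual x).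
rewrite -fourier_linear.
apply: eq_fourier => y; rewrite /indic !inE.
case: eqVneq => [->|_] /=; ring.
Qed.

Lemma latin_dual_setP A : oppr_closed A ->
  latin_square_graph (q + (0 \in A)%:R) (cayley (A :\ 0)) <->
  exists E, latin_dual_set A E.
Proof.
set D := A :\ 0; set r := q + _ => A_opp.
have D_0 : 0 \notin D by rewrite !inE eqxx.
have D_opp : oppr_closed D.
  by move=> x; rewrite !inE oppr_eq0 => /andP[-> /A_opp].
split=> [A_latin | [E [E_0 E_dual]]].
  pose E := [set x | if x == 0 then 0 \in A
                     else fourier (indic D) x == (N - r)%:~R].
  exists E; split=> [|x]; first by rewrite inE eqxx.
  rewrite fourier_indicD0 /indic inE; have [->|x_neq0] := eqVneq x 0.
    case: A_latin => _ _ kE _ _; rewrite fourier_indic0 // [#|D|%:R]pmulrn.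
    rewrite -(card_nbr D_0 0) kE /r; case: (0 \in A) => /=; ring.
  have := latin_square_graph_eigenvalue D_opp D_0 A_latin x_neq0.
  by rewrite /r; case: eqP => [-> _|_ [//|->]]; case: (0 \in A) => /=; ring.
apply/(strongly_regular_fourier D_opp D_0 e_dual); split=> // x.
have -> : fourier (indic D) x =
    N%:~R * indic E x + q%:~R * (N%:~R * (x == 0)%:R - 1) - (0 \in A)%:R.
  by rewrite -E_dual (fourier_indicD0 A) [RHS]addrC addKr.
rewrite cardV /indic /r; have [->|_] := eqVneq x 0.
  by rewrite E_0; case: (0 \in A) => /=; ring.
by case: (x \in E); case: (0 \in A) => /=; ring.
Qed.

Lemma latin_dual_set_opp A E :
  oppr_closed A -> latin_dual_set A E -> oppr_closed E.
Proof.
move=> A_opp [_ E_dual] x xE; have := E_dual (- x).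
rewrite fourier_even //; last by move=> y; rewrite /indic oppr_closedE.
rewrite E_dual oppr_eq0 => /addIr/(mulfI N_neq0)/eqP.
by rewrite eqr_nat xE; case: (- x \in E).
Qed.

Lemma latin_dual_set_sym A E :
  oppr_closed A -> latin_dual_set A E -> latin_dual_set E A.
Proof.
move=> A_opp [E_0 E_dual]; split=> // y; apply: (mulfI N_neq0).
have fourierE : fourier (indic A) =1
    fun x => N%:~R * indic E x + ((q * N)%:~R * (x == 0)%:R + (- q)%:~R).
  move=> x; rewrite E_dual; ring.
transitivity (fourier (fourier (indic A)) y
    - q%:~R * (N%:~R - #|V|%:R * (y == 0)%:R)).
  rewrite (eq_fourier _ fourierE) !fourier_linear fourier_delta //.
  rewrite fourier_cst //; ring.
rewrite fourier_fourier // cardV /indic oppr_closedE //; ring.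
Qed.

Section Fibres.

Variables (T : finType) (N_div : N = q * #|T|%:Z).
Implicit Types (f g : V -> T) (t : T).
Local Notation fibre f t := (f @^-1: [set t]).

Definition latin_fibres f : Prop := forall t,
  latin_square_graph (q + (f 0 == t)%:R) (cayley (fibre f t :\ 0)).

Definition latin_dual f g : Prop :=
  forall t, latin_dual_set (fibre f t) (fibre g t).

Lemma oppr_closed_fibre f t : even_fun f -> oppr_closed (fibre f t).
Proof. by move=> f_even x; rewrite !inE f_even. Qed.

Lemma exists_latin_dual f :
  even_fun f -> latin_fibres f -> exists g, latin_dual f g.
Proof.
move=> f_even f_latin.
have /fin_all_exists[E E_dual] t : exists E, latin_dual_set (fibre f t) E.
  apply/latin_dual_setP; first exact: oppr_closed_fibre.
  by rewrite !inE; apply: f_latin.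
suff /set_partition_fibres[g gE] x : (\sum_t (x \in E t) = 1)%N.
  by exists g => t; rewrite -gE.
have fourier_sum : N%:~R ^+ 2 * (x == 0)%:R =
    \sum_t (N%:~R * indic (E t) x + q%:~R * (N%:~R * (x == 0)%:R - 1)).
  rewrite -cardV -[LHS]mul1r -(fourier_cst e_dual) (fourier_comp e f (fun=> 1)).
  by apply: eq_bigr => t _; rewrite mul1r (E_dual t).2.
apply/eqP; rewrite -(eqr_nat C) natr_sum; apply/eqP/(mulfI N_neq0).
have N_divC : N%:~R = q%:~R * #|T|%:R :> C by rewrite N_div rmorphM /= -pmulrn.
move: fourier_sum; rewrite big_split /= sumr_const -mulr_sumr.
rewrite -[_ *+ #|T|]mulr_natr [X in _ + X]mulrAC -N_divC => /eqP.
rewrite -subr_eq => /eqP <-; ring.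
Qed.

Lemma latin_dual_latin_fibres f g :
  even_fun f -> latin_dual f g -> latin_fibres f.
Proof.
move=> f_even fg t; have := latin_dual_setP (oppr_closed_fibre (t := t) f_even).
by rewrite !inE => ->; exists (fibre g t).
Qed.

Lemma latin_dual_sym f g : even_fun f -> latin_dual f g -> latin_dual g f.
Proof.
move=> f_even fg t; apply: latin_dual_set_sym (fg t).
exact: oppr_closed_fibre.
Qed.

Lemma latin_dual_even f g : even_fun f -> latin_dual f g -> even_fun g.
Proof.
move=> f_even fg x.
have := latin_dual_set_opp (oppr_closed_fibre f_even) (fg (g x)).
by move=> /(_ x); rewrite !inE => /(_ (eqxx _)) /eqP.
Qed.

Lemma latin_dual0 f g : latin_dual f g -> g 0 = f 0.
Proof. by move=> /(_ (f 0))[+ _]; rewrite !inE eqxx => /eqP. Qed.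

Lemma fourier_comp_latin_dual f g (c : T -> C) x :
  latin_dual f g -> \sum_t c t = 0 -> fourier (c \o f) x = N%:~R * c (g x).
Proof.
move=> fg c_sum; rewrite fourier_comp.
under eq_bigr => t _ do rewrite (fg t).2 mulrDr.
rewrite big_split /= -[X in _ + X]mulr_suml c_sum mul0r addr0.
rewrite (bigD1 (g x)) //= /indic !inE eqxx mulr1 big1 ?addr0 1?mulrC // => t gx.
by rewrite !inE eq_sym (negPf gx) !mulr0.
Qed.

End Fibres.

End LatinSquareType.

Section DotProduct.

Variables (F : comPzRingType) (n : nat).
Implicit Types x y z : 'rV[F]_n.

Lemma dotC x y : dot x y = dot y x.
Proof. by apply: eq_bigr => j _; rewrite mulrC. Qed.

Lemma dotDr x y z : dot x (y + z) = dot x y + dot x z.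
Proof. by rewrite -big_split; apply: eq_bigr => j _; rewrite mxE mulrDr. Qed.

Lemma dot0r x : dot x 0 = 0.
Proof. by apply: big1 => j _; rewrite mxE mulr0. Qed.

Lemma dot_scale_delta x j a : dot x (a *: delta_mx 0 j) = x 0 j * a.
Proof.
rewrite /dot (bigD1 j) //= !mxE !eqxx mulr1 big1 ?addr0 // => i /negPf ij.
by rewrite !mxE ij !mulr0.
Qed.

End DotProduct.

Lemma self_duality_dot (F : finFieldType) (C : idomainType) (n : nat)
    (c : F -> C) a : additive_character c -> c a != 1 ->
  self_duality (fun x y : 'rV[F]_n => c (- dot x y)).
Proof.
move=> [c0 cD] ca; split=> [x y|x|x /rV0Pn[j xj]]; first by rewrite dotC.
  by split=> [|y z]; rewrite ?dot0r ?oppr0 // dotDr opprD cD.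
exists ((- a / x 0 j) *: delta_mx 0 j).
by rewrite dot_scale_delta mulrC divfK // opprK.
Qed.

Section RootsOfUnity.

Variable R : realType.

Lemma de_moivre (t : R) k :
  (cos t +i* sin t)%C ^+ k = (cos (t *+ k) +i* sin (t *+ k))%C.
Proof.
elim: k => [|k IHk]; first by rewrite expr0 mulr0n cos0 sin0.
rewrite exprS IHk mulrS cosD sinD; congr (_ +i* _)%C; exact: addrC.
Qed.

Lemma cos_lt1 (t : R) : 0 < t < pi *+ 2 -> cos t < 1.
Proof.
move=> /andP[t_gt0 t_lt]; have sin_half_gt0 : 0 < sin (t / 2).
  by apply: sin_gt0_pi; rewrite divr_gt0 //= ltr_pdivrMr // mulr_natr.
have -> : t = (t / 2) *+ 2 by rewrite -mulr_natr divfK // pnatr_eq0.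
rewrite cos_mulr2n cos2sin2 ltrBlDr -mulr2n ltrMn2r /=.
by rewrite ltrBlDr ltrDl exprn_gt0.
Qed.

Lemma zeta_prim_root n : (0 < n)%N -> n.-primitive_root (zeta R n).
Proof.
move=> n_gt0; have n_neq0 : n%:R != 0 :> R by rewrite pnatr_eq0 -lt0n.
have zeta_n : zeta R n ^+ n = 1.
  rewrite de_moivre -[_ *+ n]mulr_natr divfK // mulr_natl.
  by rewrite cos2pi -[pi *+ 2]add0r sinD2pi sin0.
have [k k_prim k_dvd] := prim_order_exists n_gt0 zeta_n.
suff kn : k = n by rewrite -{1}kn.
apply/eqP; rewrite eqn_leq dvdn_leq //= leqNgt; apply/negP => k_lt_n.
have := prim_expr_order k_prim; rewrite de_moivre => -[cos1 _].
suff /cos_lt1 : 0 < (2 * pi / n%:R : R) *+ k < pi *+ 2 by rewrite cos1 ltxx.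
rewrite mulr_natl -[X in 0 < X < _]mulr_natr -mulrA.
have pi2_gt0 : 0 < pi *+ 2 :> R by rewrite pmulrn_lgt0 ?pi_gt0.
rewrite mulr_gt0 ?mulr_gt0 ?invr_gt0 ?ltr0n ?(prim_order_gt0 k_prim) //=.
by rewrite gtr_pMr // mulrC ltr_pdivrMr ?ltr0n // mul1r ltr_nat.
Qed.

End RootsOfUnity.

Section PrimeField.

Variables (R : realType) (p n : nat).
Hypothesis p_prime : prime p.
Implicit Types (f g : 'rV['F_p]_n -> 'F_p) (a : 'F_p) (i : nat) (N : int).

Definition Fp_character (a : 'F_p) : R[i] := zeta R p ^+ a.

Definition Fp_pairing (x y : 'rV['F_p]_n) : R[i] := Fp_character (- dot x y).

Lemma ltn_Fp a : (a < p)%N.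
Proof. by rewrite -[X in (_ < X)%N](Fp_cast p_prime). Qed.

Let zeta_prim : p.-primitive_root (zeta R p).
Proof. exact/zeta_prim_root/prime_gt0. Qed.

Lemma Fp_character_additive : additive_character Fp_character.
Proof.
split=> // a b; rewrite /Fp_character -exprD -[RHS](prim_expr_mod zeta_prim) /=.
by rewrite [X in (_ %% X)%N](Fp_cast p_prime).
Qed.

Lemma Fp_character_inj : injective Fp_character.
Proof.
move=> a b /eqP; rewrite /Fp_character (eq_prim_root_expr zeta_prim).
by rewrite !modn_small ?ltn_Fp // => /eqP/val_inj.
Qed.

Lemma Fp_character1 : Fp_character 1 != 1.
Proof.
by rewrite -[X in _ != X]/(Fp_character 0) (inj_eq Fp_character_inj) oner_neq0.
Qed.

Lemma self_duality_Fp_pairing : self_duality Fp_pairing.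
Proof. exact: self_duality_dot Fp_character_additive Fp_character1. Qed.

Lemma walsh_fourier f : walsh R f =1 fourier Fp_pairing (Fp_character \o f).
Proof.
by move=> x; apply: eq_bigr => y _; rewrite -(Fp_character_additive.2 (f y)).
Qed.

Lemma is_dual_uniq N f g h : N != 0 ->
  is_dual R N f g -> is_dual R N f h -> g =1 h.
Proof.
move=> N_neq0 fg fh x; have {}N_neq0 : N%:~R != 0 :> R[i] by rewrite intr_eq0.
by apply/Fp_character_inj/(mulIf N_neq0); rewrite -[LHS]fg -[RHS]fh.
Qed.

Lemma latin_dual_is_dual N q f g :
  latin_dual Fp_pairing N q f g -> is_dual R N f g.
Proof.
move=> fg x; rewrite walsh_fourier mulrC; apply: fourier_comp_latin_dual fg _.
exact: sum_additive_character Fp_character_additive Fp_character1.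
Qed.

Lemma natr_Fp_eq0 i : (1 <= i <= p)%N -> (i%:R == 0 :> 'F_p) = (i == p).
Proof.
case/andP=> i_gt0; rewrite leq_eqVlt => /predU1P[-> | i_ltp].
  by rewrite eqxx -val_eqE /= val_Fp_nat // modnn.
by rewrite -val_eqE /= val_Fp_nat // modn_small // eqn0Ngt i_gt0 ltn_eqF.
Qed.

Lemma exists_natr_Fp a : exists2 i, (1 <= i <= p)%N & i%:R = a.
Proof.
have p_range : (1 <= p <= p)%N by rewrite prime_gt0 /=.
have [->|a_neq0] := eqVneq a 0.
  by exists p; rewrite ?p_range //; apply/eqP; rewrite natr_Fp_eq0 ?eqxx.
exists a; last exact: natr_Zp.
rewrite lt0n (ltnW (ltn_Fp a)) andbT.
by apply: contra_neq a_neq0 => a0; apply: val_inj.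
Qed.

(* The residue identifies the indices 1, ..., p with 'F_p, and p with 0. *)
Lemma level_setE f i : f 0 = 0 -> (1 <= i <= p)%N ->
  level_set f i = (f @^-1: [set i%:R]) :\ 0.
Proof.
move=> f0 i_range; have /andP[i_gt0 i_lep] := i_range.
apply/setP => x; have := natr_Fp_eq0 i_range.
rewrite /level_set; have [-> /eqP pE|i_neqp _] := eqVneq i p.
  by rewrite !inE pE andbC.
have i_ltp : (i < p)%N by rewrite ltn_neqAle i_neqp.
have f_eqE : (f x == i%:R) = (f x == i :> nat).
  by rewrite -val_eqE /= val_Fp_nat // modn_small.
by rewrite !inE f_eqE; case: (eqVneq x 0) => [->|//]; rewrite f0 ltn_eqF.
Qed.

Lemma all_feasible_typeP N f : f 0 = 0 ->
  all_feasible_type N f <-> latin_fibres N (N %/ p%:Z)%Z f.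
Proof.
move=> f0; have feasible_rE i : (1 <= i <= p)%N ->
    feasible_r p N i = (N %/ p%:Z)%Z + (f 0 == i%:R)%:R.
  move=> i_range; rewrite f0 eq_sym natr_Fp_eq0 // /feasible_r.
  by case: (i == p); rewrite ?addr0.
split=> [f_feasible a | f_latin i i_range].
  have [i i_range <-] := exists_natr_Fp a.
  by rewrite -feasible_rE // -level_setE //; apply: f_feasible.
by rewrite /= feasible_rE // /component_graph level_setE //; apply: f_latin.
Qed.

Lemma exists_feasible_dual N f : N ^+ 2 = (p ^ n)%N%:Z -> (p %| N)%Z ->
    even_fun f -> f 0 = 0 -> all_feasible_type N f ->
  exists g, [/\ is_dual R N f g, even_fun g, g 0 = 0 & all_feasible_type N g].
Proof.
move=> N_sqr p_dvdN f_even f0 /(all_feasible_typeP N f0) f_latin.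
have cardV : N ^+ 2 = #|{: 'rV['F_p]_n}|%:Z.
  by rewrite card_mx card_Fp // mul1n N_sqr.
have N_div : N = (N %/ p%:Z)%Z * #|'F_p|%:Z by rewrite card_Fp // divzK.
have e_dual := self_duality_Fp_pairing.
have [g fg] := exists_latin_dual e_dual cardV N_div f_even f_latin.
have g_even := latin_dual_even e_dual cardV f_even fg.
have g0 : g 0 = 0 by rewrite (latin_dual0 fg).
exists g; split=> //; first exact: latin_dual_is_dual fg.
apply/all_feasible_typeP => //.
apply: (latin_dual_latin_fibres e_dual cardV g_even).
exact: latin_dual_sym fg.
Qed.

End PrimeField.

Theorem theorem7p8 (R : realType) (p m : nat)
    (p_prime : prime p) (p_gt2 : (2 < p)%N) (m_gt0 : (0 < m)%N)
    (f : 'rV['F_p]_(2 * m) -> 'F_p) (f_even : even_fun f) (f0 : f 0 = 0)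
    (N : int) (N_type : N = (p ^ m)%N%:Z \/ N = - (p ^ m)%N%:Z)
    (f_feasible : all_feasible_type N f) :
  exists fstar : 'rV['F_p]_(2 * m) -> 'F_p,
    [/\ is_dual R N f fstar,
        forall g, is_dual R N f g -> g =1 fstar,
        even_fun fstar /\ fstar 0 = 0,
        forall i : nat, (1 <= i <= p)%N ->
          exists v k l mu : int,
            strongly_regular (component_graph fstar i) v k l mu &
        forall i : nat, (1 <= i <= p)%N -> forall v k l mu : int,
          strongly_regular (component_graph f i) v k l mu <->
          strongly_regular (component_graph fstar i) v k l mu].
Proof.
have N_sqr : N ^+ 2 = (p ^ (2 * m))%N%:Z.
  by rewrite mulnC expnM PoszM -expr2; case: N_type => ->; rewrite ?sqrrN.
have p_dvdN : (p %| N)%Z.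
  by case: N_type => ->; rewrite dvdzE ?abszN !absz_nat dvdn_exp.
have N_neq0 : N != 0.
  by rewrite -sqrf_eq0 N_sqr eqz_nat -lt0n expn_gt0 prime_gt0.
have [fstar [fstar_dual fstar_even fstar0 fstar_feasible]] :=
  exists_feasible_dual R p_prime N_sqr p_dvdN f_even f0 f_feasible.
exists fstar; split=> // [g g_dual | i i_range | i i_range v k l mu].
- exact: is_dual_uniq g_dual fstar_dual.
- by do 4!eexists; apply: fstar_feasible.
- have [f_srg fstar_srg] := (f_feasible i i_range, fstar_feasible i i_range).
  by split; [apply: strongly_regular_same_params f_srg fstar_srg
            |apply: strongly_regular_same_params fstar_srg f_srg].
Qed.
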